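(* Let $\Gamma$ be a countable amenable group. Every expansive continuous action of $\Gamma$ on a compact metrizable space that satisfies the pseudo-orbit tracing property and has positive topological entropy admits an off-diagonal asymptotic pair.
   Context: Let $\alpha=(\alpha_g)_{g\in\Gamma}$ be a continuous action of a countable group $\Gamma$ on a compact metrizable space $X$ with compatible metric $d$. The action is expansive if there is $c>0$ such that for all $x\ne y$ there is $g\in\Gamma$ with $d(\alpha_g(x),\alpha_g(y))>c$. For $S\subset\Gamma$ and $\delta>0$, an $(S,\delta)$ pseudo-orbit for $\alpha$ is a family $(x_g)_{g\in\Gamma}$ in $X$ such that $d(\alpha_s(x_g),x_{sg})<\delta$ for all $s\in S$ and $g\in\Gamma$; it is $\epsilon$-traced by $x\in X$ if $d(\alpha_g(x),x_g)<\epsilon$ for all $g\in\Gamma$. The action has the pseudo-orbit tracing property if for every $\epsilon>0$ there are $\delta>0$ and a finite set $S\subset\Gamma$ such that every $(S,\delta)$ pseudo-orbit is $\epsilon$-traced by some $x\in X$. A pair $(x,y)\in X\times X$ is asymptotic if for every $\epsilon>0$ there are at most finitely many $g\in\Gamma$ with $d(\alpha_g(x),\alpha_g(y))>\epsilon$; it is off-diagonal if $x\ne y$. Topological entropy is the usual topological entropy of a continuous action of a countable amenable group. *)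

(* Defs.v *)
From mathcomp Require Import all_boot all_order all_algebra finmap.
From mathcomp Require Import all_classical all_reals all_analysis.

Set Implicit Arguments.
Unset Strict Implicit.
Unset Printing Implicit Defensive.

Import Order.TTheory GRing.Theory Num.Theory.
Import numFieldNormedType.Exports.

Local Open Scope classical_set_scope.
Local Open Scope ring_scope.

Section Amenable.
Variables (R : realType) (G : groupType).

Definition left_translate (s : G) (F : {fset G}) : {fset G} :=
  [fset (s * g)%g | g in F]%fset.

(* [F] is nonempty and |sF \triangle F| <= e |F| for every s in [K]. *)
Definition folner_invariant (K : {fset G}) (e : R) : set {fset G} :=
  [set F | F != fset0 /\ forall s, s \in K ->
     #|` (left_translate s F `\` F) `|` (F `\` left_translate s F)|%fset%:R
       <= e * #|` F|%:R].

(* Folner's condition. *)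
Definition amenable : Prop :=
  forall (K : {fset G}) (e : R), 0 < e -> folner_invariant K e !=set0.

(* "[F] becomes more and more left-invariant"; a proper filter iff [G] is
   amenable. *)
Definition folner_filter : set_system {fset G} :=
  filter_from [set Ke : {fset G} * R | 0 < Ke.2]
    (fun Ke => folner_invariant Ke.1 Ke.2).

End Amenable.

Section Dynamics.
Variables (R : realType) (G : groupType) (X : metricType R).
Variable alpha : G -> X -> X.

Definition continuous_action : Prop :=
  [/\ forall x, alpha 1%g x = x,
      forall g h x, alpha (g * h)%g x = alpha g (alpha h x) &
      forall g, continuous (alpha g)].

Definition expansive : Prop :=
  exists2 c : R, 0 < c &
    forall x y, x <> y -> exists g, c < mdist (alpha g x) (alpha g y).

Definition pseudo_orbit (S : set G) (delta : R) (x_ : G -> X) : Prop :=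
  forall s g, S s -> mdist (alpha s (x_ g)) (x_ (s * g)%g) < delta.

Definition traced (eps : R) (x_ : G -> X) (x : X) : Prop :=
  forall g, mdist (alpha g x) (x_ g) < eps.

Definition pseudo_orbit_tracing : Prop :=
  forall eps : R, 0 < eps ->
    exists (delta : R) (S : set G), [/\ 0 < delta, finite_set S &
      forall x_, pseudo_orbit S delta x_ -> exists x, traced eps x_ x].

Definition asymptotic (x y : X) : Prop :=
  forall eps : R, 0 < eps ->
    finite_set [set g | eps < mdist (alpha g x) (alpha g y)].

Definition open_cover (U : set (set X)) : Prop :=
  (forall A, U A -> open A) /\ \bigcup_(A in U) A = setT.

(* Minimal cardinality of a subcover, +oo if there is no finite subcover. *)
Definition cover_number (U : set (set X)) : \bar R :=
  ereal_inf [set (#|` V|%:R)%:E | V in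
    [set V : {fset (set X)} |
       [set` V] `<=` U /\ \bigcup_(A in [set` V]) A = setT]].

(* The join of the covers alpha_g^{-1} U for g in F. *)
Definition cover_join (U : set (set X)) (F : {fset G}) : set (set X) :=
  [set \bigcap_(g in [set` F]) (alpha g @^-1` s g) | s in
    [set s : G -> set X | forall g, g \in F -> U (s g)]].

(* log N(U^F) / |F| *)
Definition mean_cover_entropy (U : set (set X)) (F : {fset G}) : \bar R :=
  (lne (cover_number (cover_join U F)) * (#|` F|%:R^-1)%:E)%E.

(* The upper limit along [folner_filter], spelled out because [limf_esup] asks
   for a filtered structure on {fset G}.  By the Ornstein-Weiss lemma it is a
   limit, and it agrees with the limit along any left Folner sequence. *)
Definition cover_entropy (U : set (set X)) : \bar R :=
  ereal_inf [set ereal_sup (mean_cover_entropy U @` A) |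
              A in @folner_filter R G].

Definition topological_entropy : \bar R :=
  ereal_sup [set cover_entropy U | U in open_cover].

End Dynamics.

(* Main.v *)
Require Import Defs.
From mathcomp Require Import all_boot all_order all_algebra finmap.
From mathcomp Require Import all_classical all_reals all_analysis.
From mathcomp Require Import lra.

Local Open Scope classical_set_scope.

Set Implicit Arguments.
Unset Strict Implicit.
Unset Printing Implicit Defensive.

Import Order.TTheory GRing.Theory Num.Theory.
Import numFieldNormedType.Exports.

Local Open Scope ring_scope.

(** Two points that share a long piece of boundary but differ inside can be cut
and pasted: follow the orbit of [x] on a finite set [F] and that of [y] off
[F].  The result is an exact orbit except where a step [g -> s g], [s] in [S],
crosses the border of [F]; so it is an [(S, d)] pseudo-orbit as soon as
[alpha_g x] and [alpha_g y] are [d]-close for [g] in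
[boundary S F], the union over [s] in [S] of the symmetric differences of [sF]
and [F] ([surgery_pseudo_orbit]).  A point [z] tracing it stays within the
expansivity constant of the orbit of [y] off [F], and an expansive action
upgrades such a bound to asymptoticity ([asymptotic_of_close_off_finite]).  If
moreover the orbits of [x] and [y] are at least as far apart as the tracing
precision somewhere in [F], then [z] is not [y].

Positive entropy supplies [x] and [y] by counting.  Some open cover [U] and
some [h > 0] satisfy [log N(U^F) > h |F|] for arbitrarily invariant [F], where
[N] counts a minimal subcover and [U^F] joins the pullbacks of [U] along [F]
([positive_entropy]).  Split [X] into [m] cells whose points are less than [d]
apart, and record, for each point, the cells that its orbit visits over the boundary.  At
most [m ^ |boundary S F|] records occur, and invariance makes the boundary so
small that this number is below [N(U^F)] ([card_boundary_le]).  If points with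
equal records were always closer along [F] than a Lebesgue number [r] of [U],
every set of points with a given record would lie in one member of [U^F], which
bounds [N(U^F)] by the number of records, a contradiction
([cover_join_separation]).  The tracing precision is the minimum of [r] and the
expansivity constant: the first keeps [z] off [y], the second makes the pair
asymptotic. *)

(** * Compactness *)

(** The near-covering form of compactness, for the filter on finite subsets of
[I] generated by the families of all finite sets that contain a given one. *)
Lemma compact_fset_cover (T : topologicalType) (I : choiceType) (K : set T)
    (P : I -> set T) :
  compact K -> (forall x, K x -> exists i, nbhs x (P i)) ->
  exists D : {fset I}, forall x, K x -> exists2 i, i \in D & P i x.
Proof.
move=> /compact_near_coveringP cK KP.
pose F := filter_from [set: {fset I}] (fun D => [set E | D `<=` E]%fset).
have FF : Filter F.
  apply: filter_from_filter; first by exists fset0.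
  move=> D E _ _; exists (D `|` E)%fset => // Z /= DEZ; split => /=.
    exact: fsubset_trans (fsubsetUl _ _) DEZ.
  exact: fsubset_trans (fsubsetUr _ _) DEZ.
have [x Kx|D _ DK] := cK _ F (fun D x => exists2 i, i \in D & P i x) FF.
  have [i xPi] := KP x Kx.
  exists (P i, [set E | [fset i] `<=` E]%fset); first by
    split => //; exists [fset i]%fset.
  move=> [y E] [/= Piy iE]; exists i => //.
  by rewrite (fsubsetP iE)// in_fset1.
by exists D => x Kx; apply: DK => //=; exact: fsubset_refl.
Qed.

Section CompactMetric.
Variables (R : realType) (X : metricType R).

Lemma mdist_triangle (x y z : X) : mdist x z <= mdist x y + mdist y z.
Proof. exact: metric_triangle. Qed.

Lemma mdistC (x y : X) : mdist x y = mdist y x.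
Proof. exact: metric_sym. Qed.

Lemma nbhs_mdist (x : X) (r : R) : 0 < r -> nbhs x [set y | mdist x y < r].
Proof. by move=> r0; rewrite -ballEmdist; exact: nbhsx_ballx. Qed.

(** For [y] near [x], the ball of small radius around [y] stays in the member of
[U] that contains [x]; compactness makes the radius uniform. *)
Lemma lebesgue_number (U : set (set X)) :
  compact [set: X] -> open_cover U ->
  exists2 r : R, 0 < r &
    forall x, exists2 A, U A & [set y | mdist x y < r] `<=` A.
Proof.
move=> /compact_near_coveringP cX [Uo Uc].
pose P (r : R) (x : X) := exists2 A, U A & [set y | mdist x y < r] `<=` A.
have [x _|e /= e0 Pe] := cX _ (0 : R)^'+ P _.
  have [A UA Ax] : (\bigcup_(A in U) A) x by rewrite Uc.
  have /nbhs_ballP[r /= r0 rA] : nbhs x A.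
    by apply: open_nbhs_nbhs; split => //; exact: Uo.
  exists ([set y | mdist x y < r / 2], [set s | s < r / 2]) => /=.
    split; first by apply: nbhs_mdist; lra.
    by apply: nbhs_right_lt; lra.
  move=> [y s] [/= xy sr]; exists A => // z /= yz; apply: rA; rewrite ballEmdist/=.
  have xyz := mdist_triangle x y z; lra.
exists (e / 2); first lra.
move=> x; apply: (Pe (e / 2)) => //=; last lra.
by rewrite /ball/= sub0r normrN gtr0_norm; lra.
Qed.

Lemma compact_finite_partition (d : R) :
  compact [set: X] -> 0 < d ->
  exists (T : finType) (k : X -> T), forall x y, k x = k y -> mdist x y < d.
Proof.
move=> cX d0.
have [x _|D DX] :=
    @compact_fset_cover _ _ _ (fun a => [set y : X | mdist a y < d / 2]) cX.
  by exists x; apply: nbhs_mdist; lra.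
have f x : {a : D | mdist (val a) x < d / 2}.
  apply: cid; have [a aD ax] := DX x I.
  by exists [` aD]%fset.
exists D, (fun x => sval (f x)) => x y /= fxy.
have fx := svalP (f x); have := svalP (f y); rewrite -fxy => fy.
have xy := mdist_triangle x (val (sval (f x))) y; move: xy fx fy.
rewrite (mdistC x (val _)); lra.
Qed.

End CompactMetric.

(** * Covering numbers *)

Section CoverNumber.
Variable R : realType.

(** The successor keeps the logarithm nonnegative for every [m], including the
value [0] that occurs when the space is empty. *)
Lemma expn_lt_of_lne (N : \bar R) (m n : nat) :
  ((n%:R * ln m.+1%:R)%:E < lne N)%E -> ((m ^ n)%:R%:E < N)%E.
Proof.
rewrite !ltNge; apply: contra => few.
have {}few : (N <= (m.+1%:R ^+ n : R)%:E)%E.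
  apply: le_trans few _; rewrite lee_fin natrX lerXn2r ?nnegrE ?ler0n//.
  by rewrite ler_nat.
have [N0|N0] := leP N 0%E; first by rewrite le0_lneNy// leNye.
apply: (@le_trans _ _ (lne (m.+1%:R ^+ n : R)%:E)).
  by rewrite lee_lne// in_itv/= ?leey ?andbT ?(ltW N0)// lee_fin exprn_ge0.
by rewrite lne_EFin ?exprn_gt0// lnXn// lee_fin -[_ *+ n]mulr_natl.
Qed.

(** Pick one member of [U] for each value of [k]: it covers the whole fibre. *)
Lemma cover_number_le (X : metricType R) (U : set (set X)) (T : finType)
    (k : X -> T) :
  (forall x, exists2 A, U A & forall y, k y = k x -> A y) ->
  (cover_number U <= (#|T|%:R : R)%:E)%E.
Proof.
move=> kU.
have /choice[f Uf] : forall t : T, exists A : set X,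
    (exists x, k x = t) -> U A /\ forall y, k y = t -> A y.
  move=> t; have [[x <-]|nt] := pselect (exists x, k x = t).
    by have [A UA kA] := kU x; exists A.
  (* a label that no point carries; it is filtered out below *)
  by exists set0.
pose L := [seq t <- enum T | `[< exists x, k x = t >]].
have inL t : t \in L <-> exists x, k x = t.
  by rewrite mem_filter mem_enum andbT; split => /asboolP.
apply: ge_ereal_inf; exists (#|` [fset f t | t in L]%fset |%:R)%:E.
  exists [fset f t | t in L]%fset => //=; split.
    by move=> _ /= /imfsetP[t /= /inL/Uf[UA _] ->].
  apply/seteqP; split => // x _; exists (f (k x)); last first.
    by have [|_ kA] := Uf (k x); [exists x | exact: kA].
  by apply/imfsetP; exists (k x) => //=; apply/inL; exists x.
rewrite lee_fin ler_nat (leq_trans (leq_imfset_card _ _ _))//=.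
rewrite cardE (leq_trans (size_undup _))// size_filter.
exact: count_size.
Qed.

End CoverNumber.

(** * Boundaries of finite sets *)

Section Boundary.
Variables (R : realType) (G : groupType).
Implicit Types (S F : {fset G}) (e : R).
Local Open Scope fset_scope.

Definition translation_diff F (s : G) : {fset G} :=
  (left_translate s F `\` F) `|` (F `\` left_translate s F).

Definition boundary S F : {fset G} := \bigcup_(s <- S) translation_diff F s.

Lemma mem_left_translate (s g : G) F :
  ((s * g)%g \in left_translate s F) = (g \in F).
Proof.
apply/imfsetP/idP => /= [[h hF /mulgI ->]//|gF].
by exists g.
Qed.

Lemma mem_boundary S F (s g : G) : s \in S -> (g \in F) != ((s * g)%g \in F) ->
  (s * g)%g \in boundary S F.
Proof.
move=> sS gF; apply/bigfcupP; exists s; first by rewrite sS.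
rewrite in_fsetU !in_fsetD mem_left_translate.
by case: (g \in F) gF; case: (_ \in F).
Qed.

(** Each translate contributes at most the proportion [e] allowed by invariance.
*)
Lemma card_boundary_le S F e : folner_invariant S e F ->
  (#|` boundary S F|%:R <= #|` S|%:R * (e * #|` F|%:R))%R.
Proof.
move=> [_ FS]; rewrite /boundary.
suff H (t : seq G) : {subset t <= S} ->
    (#|` \bigcup_(s <- t) translation_diff F s|%:R <=
      (size t)%:R * (e * #|` F|%:R))%R by exact: (H S).
elim: t => [|s t IH] st; first by rewrite big_nil cardfs0 mul0r.
rewrite big_cons /= -addn1 natrD mulrDl mul1r addrC.
apply: le_trans (_ : (#|` translation_diff F s|%:R +
    #|` \bigcup_(j <- t) translation_diff F j|%:R <= _)%R).
  by rewrite -natrD ler_nat leq_card_fsetU.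
apply: lerD; first by apply: FS; apply: st; rewrite inE eqxx.
by apply: IH => u ut; apply: st; rewrite inE ut orbT.
Qed.

End Boundary.

(** * Entropy, surgery of orbits and expansivity *)

Section Dynamics.
Variables (R : realType) (G : groupType) (X : metricType R).
Variable alpha : G -> X -> X.

(** The infimum over the Folner filter lies below the supremum over each
invariance class, so any [h] below the entropy of the cover is exceeded in all
of them. *)
Lemma positive_entropy : (0 < topological_entropy alpha)%E ->
  exists U (h : R), [/\ open_cover U, 0 < h &
    forall (K : {fset G}) (e : R), 0 < e ->
      exists2 F, folner_invariant K e F &
        ((h * #|` F|%:R)%:E < lne (cover_number (cover_join alpha U F)))%E].
Proof.
move=> /ereal_sup_gt[_ [U Uo <-] U0].
have [h h0 hU] : exists2 h : R, 0 < h & (h%:E < cover_entropy alpha U)%E.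
  case: (cover_entropy alpha U) U0 => [u| |]//.
    by rewrite lte_fin => u0; exists (u / 2); rewrite ?lte_fin; lra.
  by move=> _; exists 1; rewrite ?ltry.
exists U, h; split => // K e e0.
have : (h%:E < ereal_sup
    (mean_cover_entropy alpha U @` folner_invariant K e))%E.
  apply: lt_le_trans hU _; apply: ereal_inf_lbound.
  by exists (folner_invariant K e) => //; exists (K, e).
move=> /ereal_sup_gt[_ [F KF <-]] hF; exists F => //.
have F0 : (0 < #|` F|%:R :> R) by rewrite ltr0n cardfs_gt0; case: KF.
by move: hF; rewrite lte_pdivlMr// EFinM.
Qed.

(** The record of [x] is the function [g |-> k (alpha_g x)] on [B]. If equal
records forced [r]-closeness along [F], the member of the join that follows the
[r]-balls around the orbit of [x] would contain every point with the record of
[x], and the covering number would not exceed the number of records. *)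
Lemma cover_join_separation (U : set (set X)) (F B : {fset G}) (r : R)
    (T : finType) (k : X -> T) :
  (forall x, exists2 A, U A & [set y | mdist x y < r] `<=` A) ->
  ((#|T| ^ #|` B|)%:R%:E < cover_number (cover_join alpha U F))%E ->
  exists x y, (forall g, g \in B -> k (alpha g x) = k (alpha g y)) /\
    exists2 g, g \in F & r <= mdist (alpha g x) (alpha g y).
Proof.
move=> rU; rewrite cardfE -card_ffun ltNge => /negP nle; apply: contrapT => nsep.
apply: nle.
apply: (cover_number_le (k := fun x => [ffun b : B => k (alpha (val b) x)])).
move=> x; have /choice[s sP] : forall g, exists A, U A /\
    [set y | mdist (alpha g x) y < r] `<=` A.
  by move=> g; have [A UA rA] := rU (alpha g x); exists A.
exists (\bigcap_(g in [set` F]) (alpha g @^-1` s g)).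
  by exists s => // g _; have [] := sP g.
move=> y kyx g /= gF; have [_] := sP g; apply => /=.
rewrite ltNge; apply/negP => rxy; apply: nsep; exists x, y; split; last by exists g.
by move=> b bB; move/ffunP: kyx => /(_ [` bB]%fset); rewrite !ffunE.
Qed.

(** A step between two elements of [F], or two elements outside, makes no error;
a step that crosses the border lands in the boundary. *)
Lemma surgery_pseudo_orbit (S F : {fset G}) (d : R) (x y : X) :
  continuous_action alpha -> 0 < d ->
  (forall g, g \in boundary S F -> mdist (alpha g x) (alpha g y) < d) ->
  pseudo_orbit alpha [set` S] d
    (fun g => if g \in F then alpha g x else alpha g y).
Proof.
move=> [_ aM _] d0 xy s g /= sS.
have [gsg|] := eqVneq (g \in F) ((s * g)%g \in F).
  by rewrite -gsg; case: ifP => _; rewrite -aM mdistxx.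
move=> /(mem_boundary sS)/xy.
by case: (g \in F); case: ((s * g)%g \in F); rewrite -aM ?mdistxx // mdistC.
Qed.

(** On the compact square, expansivity opens a neighbourhood of each pair off the
diagonal on which one [g] separates, and the pairs at distance less than [e]
are a neighbourhood of the diagonal; finitely many [g] suffice. *)
Lemma uniform_expansivity (c e : R) :
  compact [set: X] -> continuous_action alpha -> 0 < e ->
  (forall x y, x <> y -> exists g, c < mdist (alpha g x) (alpha g y)) ->
  exists K : {fset G}, forall x y,
    (forall g, g \in K -> mdist (alpha g x) (alpha g y) <= c) ->
    mdist x y < e.
Proof.
move=> cX [_ _ ac] e0 exp.
pose P g : set (X * X) := [set p |
  c < mdist (alpha g p.1) (alpha g p.2) \/ mdist p.1 p.2 < e].
have [[x y] _|K KP] := compact_fset_cover (P := P) (compact_setX cX cX).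
  have [<-|/eqP/exp[g cg]] := eqVneq x y.
    exists 1%g; exists ([set z | mdist x z < e / 2], [set z | mdist x z < e / 2]).
      by split; apply: nbhs_mdist; lra.
    move=> [u v] [/= xu xv]; right => /=.
    have := mdist_triangle u x v; rewrite (mdistC u x); lra.
  pose t := (mdist (alpha g x) (alpha g y) - c) / 2.
  have near_alpha z : nbhs z [set w | mdist (alpha g z) (alpha g w) < t].
    by apply: (ac g z [set w | mdist (alpha g z) w < t]); apply: nbhs_mdist; rewrite /t; lra.
  exists g; exists ([set w | mdist (alpha g x) (alpha g w) < t],
               [set w | mdist (alpha g y) (alpha g w) < t]); first by split.
  move=> [u v] [/= xu yv]; left => /=; move: xu yv; rewrite /t.
  have := mdist_triangle (alpha g x) (alpha g u) (alpha g y).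
  have := mdist_triangle (alpha g u) (alpha g v) (alpha g y).
  rewrite (mdistC (alpha g v) (alpha g y)); lra.
exists K => x y Kxy; have [|g gK []//=] := KP (x, y); first by split.
by rewrite ltNge Kxy.
Qed.

(** With [K] from [uniform_expansivity] for [e], the orbits are [e]-close at
[g] unless [K g] meets [F], that is unless [g] lies in the finite set [K^-1 F].
*)
Lemma asymptotic_of_close_off_finite (c : R) (F : {fset G}) (x y : X) :
  compact [set: X] -> continuous_action alpha ->
  (forall u v, u <> v -> exists g, c < mdist (alpha g u) (alpha g v)) ->
  (forall g, g \notin F -> mdist (alpha g x) (alpha g y) <= c) ->
  asymptotic alpha x y.
Proof.
move=> cX act exp Fxy e e0; have [_ aM _] := act.
have [K KP] := uniform_expansivity cX act e0 exp.
apply: (@finite_subfset _ [fset (k^-1 * f)%g | k in K, f in F]%fset).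
move=> g /= eg; apply: contrapT => gKF.
suff : mdist (alpha g x) (alpha g y) < e by rewrite ltNge (ltW eg).
apply: KP => k kK; rewrite -!aM; apply: Fxy; apply/negP => kgF; apply: gKF.
by apply/imfset2P; exists k => //; exists (k * g)%g => //; rewrite mulKg.
Qed.

End Dynamics.

Theorem theorem1p4 (R : realType) (G : groupType) (X : metricType R)
    (alpha : G -> X -> X)
    (countable_G : countable [set: G]) (amenable_G : amenable R G)
    (compact_X : compact [set: X])
    (action_alpha : continuous_action alpha)
    (expansive_alpha : expansive alpha)
    (tracing_alpha : pseudo_orbit_tracing alpha)
    (entropy_alpha : (0 < topological_entropy alpha)%E) :
  exists x y : X, x <> y /\ asymptotic alpha x y.
Proof.
have [c c0 exp] := expansive_alpha.
have [U [h [Uo h0 hU]]] := positive_entropy entropy_alpha.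
have [r r0 rU] := lebesgue_number compact_X Uo.
pose eps := Num.min c r.
have eps0 : 0 < eps by rewrite lt_min c0.
have [d [S0 [d0 /finite_fsetP[S ->] tr]]] := tracing_alpha _ eps0.
have [T [k kd]] := compact_finite_partition compact_X d0.
pose l : R := ln #|T|.+1%:R.
have l0 : 0 <= l by rewrite ln_ge0// ler1n.
have lS0 : 0 <= l * #|` S|%:R by rewrite mulr_ge0.
(* [l |S| e < h]: the records over the boundary then grow more slowly than
   the covering numbers. *)
pose e := h / (l * #|` S|%:R + 1).
have e0 : 0 < e by rewrite divr_gt0//; lra.
have [F FS hF] := hU S e e0.
have F0 : (0 < #|` F|%:R :> R) by rewrite ltr0n cardfs_gt0; case: FS.
have many : ((#|T| ^ #|` boundary S F|)%:R%:E <
    cover_number (cover_join alpha U F) :> \bar R)%E.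
  apply: expn_lt_of_lne; apply: le_lt_trans hF; rewrite lee_fin -/l.
  apply: le_trans (ler_wpM2r l0 (card_boundary_le FS)) _.
  rewrite mulrC !mulrA; apply: ler_wpM2r; first exact: ltW.
  rewrite /e ler_pdivrMr; last lra.
  by rewrite mulrC mulrDr mulr1 lerDl ltW.
have [x [y [xyB [g gF rxy]]]] := cover_join_separation k rU many.
have [z zP] := tr _ (surgery_pseudo_orbit action_alpha d0
  (fun g gB => kd _ _ (xyB g gB))).
exists z, y; split.
  move=> zy; have := zP g; rewrite gF zy mdistC ltNge => /negP; apply.
  by rewrite (le_trans _ rxy)// ge_min lexx orbT.
apply: (asymptotic_of_close_off_finite compact_X action_alpha exp (F := F)).
move=> u uF; have := zP u; rewrite (negbTE uF) => /ltW zy.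
by rewrite (le_trans zy)// ge_min lexx.
Qed.
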